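(* Let $\alpha\in(0,1)$, let $(P_\theta:\theta\in\Theta)$ be a collection of distributions with densities $p_\theta$ with respect to a common measure $\mu$, and let $Y_1,Y_2,\dots$ be i.i.d. from $P_{\theta^*}$, $\theta^*\in\Theta$. For each $t\ge1$ let $\widehat\theta_{1,t-1}\in\Theta$ be any non-anticipating estimator, i.e. one based on $Y_1,\dots,Y_{t-1}$ only. Define $$R_t(\theta)=\frac{\prod_{i=1}^tp_{\widehat\theta_{1,i-1}}(Y_i)}{\prod_{i=1}^tp_\theta(Y_i)},\qquad C_t=\{\theta\in\Theta:R_t(\theta)\le1/\alpha\},\qquad \bar C_t=\bigcap_{s\le t}C_s .$$ Then $C_t$ and $\bar C_t$ are confidence sequences for $\theta^*$, meaning that $$P_{\theta^*}(\exists t\in\mathbb N:\theta^*\notin\bar C_t)\le\alpha .$$ Equivalently, $P_{\theta^*}(\theta^*\in C_\tau)\ge1-\alpha$ for any stopping time $\tau$, and also $P_{\theta^*}(\theta^*\in C_T)\ge1-\alpha$ for any arbitrary random time $T$.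
   Context: Stopping times are with respect to the natural filtration $\mathcal F_t=\sigma(Y_1,\dots,Y_t)$; stopping times and random times take values in $\mathbb N=\{1,2,\dots\}$, and a random time may depend arbitrarily on the whole data sequence. The initial estimator $\widehat\theta_{1,0}$ is a fixed element of $\Theta$. All quantities are assumed measurable as needed. *)

(* Defs.v *)
From HB Require Import structures.
From mathcomp Require Export all_boot all_order all_algebra.
From mathcomp Require Export finmap.
From mathcomp Require Export all_classical all_reals all_analysis.

Set Implicit Arguments.
Unset Strict Implicit.
Unset Printing Implicit Defensive.

Import Order.TTheory GRing.Theory Num.Theory.
Import numFieldNormedType.Exports.

Local Open Scope classical_set_scope.
Local Open Scope ring_scope.

Definition is_density (d : measure_display) (X : measurableType d)
    (R : realType) (mu : {measure set X -> \bar R}) (P : probability X R)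
    (f : X -> R) : Prop :=
  [/\ measurable_fun [set: X] f,
      (forall x, 0 <= f x) &
      (forall A, measurable A -> P A = \int[mu]_(x in A) (f x)%:E)%E].

Definition mutually_independent (d d' : measure_display)
    (Omega : measurableType d) (X : measurableType d') (R : realType)
    (Q : probability Omega R) (I : choiceType) (Y : I -> {RV Q >-> X}) : Prop :=
  forall (J : {fset I}) (A : I -> set X),
    (forall i, measurable (A i)) ->
    (Q (\bigcap_(i in [set` J]) (Y i @^-1` A i)) =
      \prod_(i <- J) Q (Y i @^-1` A i))%E.

(* Here and below observations are numbered from 0: [Y i] stands for
   $Y_{i+1}$, and a time [t >= 1] is the number of observations seen so far. *)
Definition iid (d d' : measure_display)
    (Omega : measurableType d) (X : measurableType d') (R : realType)
    (Q : probability Omega R) (Y : nat -> {RV Q >-> X})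
    (P : probability X R) : Prop :=
  mutually_independent Y /\
  forall i A, measurable A -> distribution Q (Y i) A = P A.

(* The sigma-algebra generated by [Y 0, ..., Y t.-1]. *)
Definition natural_filtration (d d' : measure_display)
    (Omega : measurableType d) (X : measurableType d')
    (Y : nat -> Omega -> X) (t : nat) : set (set Omega) :=
  g_sigma_preimage (fun i : 'I_t => Y i).

Definition is_stopping_time (Omega : Type) (F : nat -> set (set Omega))
    (tau : Omega -> nat) : Prop :=
  (forall w, (1 <= tau w)%N) /\ forall t, F t [set w | (tau w <= t)%N].

(* No adaptedness: a random time may look at the whole data sequence. *)
Definition is_random_time (d : measure_display) (Omega : measurableType d)
    (T : Omega -> nat) : Prop :=
  (forall w, (1 <= T w)%N) /\ measurable_fun [set: Omega] T.

Section UniversalInference.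
Context (R : realType) (Theta X : Type).
Variables (p : Theta -> X -> R).

(* [est i] is computed from the first [i] observations only, which is what
   makes it non-anticipating; [est 0] is a fixed element of [Theta]. *)
Variable est : forall i : nat, i.-tuple X -> Theta.
Variable alpha : R.

(* The quotient is taken in the extended reals, where a positive number
   divided by 0 is [+oo] (and 0 / 0 is 0). *)
Definition lik_ratio (y : nat -> X) (t : nat) (theta : Theta) : \bar R :=
  ((\prod_(i < t) p (est [tuple y j | j < i]) (y i))%:E
   / (\prod_(i < t) p theta (y i))%:E)%E.

Definition conf_set (y : nat -> X) (t : nat) : set Theta :=
  [set theta | (lik_ratio y t theta <= (1 / alpha)%:E)%E].

Definition running_conf_set (y : nat -> X) (t : nat) : set Theta :=
  \bigcap_(s in [set s | (1 <= s <= t)%N]) conf_set y s.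

End UniversalInference.

(* [D t w] is the set reported at time [t >= 1] under outcome [w]. *)
Definition is_confidence_sequence (d : measure_display)
    (Omega : measurableType d) (R : realType) (Q : probability Omega R)
    (Theta : Type) (D : nat -> Omega -> set Theta) (theta : Theta)
    (alpha : R) : Prop :=
  (Q [set w | exists2 t, (1 <= t)%N & ~ D t w theta] <= alpha%:E)%E.

(* Main.v *)
(* On the event that no [p theta* (Y_i)] vanishes, which has probability 1, the
   ratio R_t(theta* ) is the wealth of a gambler whose t-th bet multiplies it by
   p_est(Y_t) / p_theta*(Y_t), a factor of conditional mean at most 1. Stop the
   gambler, with nothing left, as soon as the wealth exceeds c = 1/alpha: the
   mean of the remaining wealth at time t, plus c times the probability of having
   stopped by then, never increases and starts at 1. Hence the crossing
   probabilities sum up to at most 1/c = alpha. A single such event covers all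
   the (random) times at once. Only the law of Y_t given the past enters the
   product measures, so mu need not be sigma-finite. *)
From HB Require Import structures.
Require Import Defs.
From mathcomp Require Import all_boot all_order all_algebra.
From mathcomp Require Import all_classical all_reals all_analysis.
From mathcomp Require Import measurable_realfun.

Set Implicit Arguments.
Unset Strict Implicit.
Unset Printing Implicit Defensive.

Import Order.TTheory GRing.Theory Num.Theory.
Import numFieldNormedType.Exports.

Local Open Scope classical_set_scope.
Local Open Scope ring_scope.

(** * Integration against a law that has a density *)

Section Density.
Context (R : realType) (d : measure_display) (X : measurableType d).
Variable mu : {measure set X -> \bar R}.
Local Open Scope ereal_scope.
Import HBNNSimple.

(** For the indicator of a measurable set this is the defining identity of a density. Linearity
    gives simple functions, and monotone convergence under both [P] and [mu] gives the rest. *)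
Lemma ge0_integral_density (P : probability X R) (f : X -> R)
    (hf : is_density mu P f) (g : X -> \bar R) :
    measurable_fun [set: X] g -> (forall x, 0 <= g x) ->
  \int[P]_x g x = \int[mu]_x (g x * (f x)%:E).
Proof.
move=> mg g0; have [mf f0 Pf] := hf.
have mfE : measurable_fun [set: X] (EFin \o f) by exact/measurable_EFinP.
have f0E x : 0 <= (f x)%:E by rewrite lee_fin.
have [h [ndh cvgh]] := approximation measurableT mg (fun x _ => g0 x).
have ndhx x : {homo h^~ x : m n / (m <= n)%N >-> (m <= n)%R}.
  by move=> m n /ndh /lefP.
have simpleE n : sintegral P (h n) = \int[mu]_x ((h n x)%:E * (f x)%:E).
  transitivity (\int[mu]_x \sum_(y \in range (h n))
      (y%:E * ((\1_(h n @^-1` [set y]) x)%:E * (f x)%:E))); last first.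
    apply: eq_integral => x _; rewrite [in RHS]fimfunE -fsumEFin//.
    rewrite ge0_mule_fsuml => [|y]; last exact: nnfun_muleindic_ge0.
    by apply: eq_fsbigr => y _; rewrite EFinM muleA.
  rewrite sintegralE ge0_integral_fsum//.
  - apply: eq_fsbigr => y /[!inE] -[x _ <-].
    rewrite ge0_integralZl//.
    + congr (_ * _); apply: (etrans (Pf _ _)) => //.
      rewrite integral_mkcond; apply: eq_integral => z _.
      by rewrite epatch_indic muleC.
    + by apply: emeasurable_funM => //; exact/measurable_EFinP.
    + by move=> z _; rewrite mule_ge0// lee_fin.
    + by rewrite lee_fin.
  - move=> y; apply: emeasurable_funM => //; apply: emeasurable_funM => //.
    exact/measurable_EFinP.
  - move=> y x _; rewrite muleA mule_ge0//.
    exact: nnfun_muleindic_ge0.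
rewrite (nd_ge0_integral_lim P g0 ndhx (fun x => cvgh x I)).
transitivity (\int[mu]_x limn (fun n => (h n x)%:E * (f x)%:E)); last first.
  apply: eq_integral => x _; apply/cvg_lim => //.
  by apply: cvgeZr => //; exact: cvgh.
rewrite monotone_convergence//.
- by congr (limn _); apply/funext => n /=.
- by move=> n; apply: emeasurable_funM => //; exact/measurable_EFinP.
- by move=> n x _; rewrite mule_ge0// lee_fin.
- by move=> x _ m n mn; rewrite lee_wpmul2r ?lee_fin ?f0 ?ndhx.
Qed.

Lemma measurable_fun_ratio d' (T : measurableType d') (f g : T -> R) :
    measurable_fun [set: T] f -> measurable_fun [set: T] g ->
  (forall x, (0 <= g x)%R) -> measurable_fun [set: T] (fun x => f x / g x)%R.
Proof.
move=> mf mg g0; apply: measurable_funM => //.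
(* The power [-1] agrees with the inverse on all nonnegative reals; at 0 both are 0. *)
apply: (eq_measurable_fun (fun x => g x `^ (-1))%R) => [x _|].
  by rewrite powR_inv1.
exact: (measurableT_comp (measurable_powR (-1)%R) mg).
Qed.

(** Under [mu] the integrand becomes [p' x / p x * p x], which is [p' x] where [p x] is nonzero and
    0 elsewhere. The mass that [P'] puts on the zeros of [p] is lost, hence only an inequality. *)
Lemma integral_density_ratio_le1 (P P' : probability X R) (p p' : X -> R) :
    is_density mu P p -> is_density mu P' p' ->
  \int[P]_x (p' x / p x)%:E <= 1.
Proof.
move=> hp [mp' p'0 Pp']; have [mp p0 _] := hp.
have mr : measurable_fun [set: X] (fun x => p' x / p x)%R.
  exact: measurable_fun_ratio.
rewrite (ge0_integral_density hp); last 2 first.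
- exact/measurable_EFinP.
- by move=> x; rewrite lee_fin divr_ge0.
have <- : P' [set: X] = 1 by exact: probability_setT.
rewrite Pp'//; apply: ge0_le_integral => //=.
- by move=> x _; rewrite -EFinM lee_fin mulr_ge0// divr_ge0.
- by apply: emeasurable_funM; exact/measurable_EFinP.
- exact/measurable_EFinP.
move=> x _; rewrite -EFinM lee_fin.
by have [->|px0] := eqVneq (p x) 0%R; rewrite ?mulr0// divfK.
Qed.

Lemma density_eq0_null (P : probability X R) (p : X -> R) :
  is_density mu P p -> P (p @^-1` [set 0%R]) = 0.
Proof.
move=> [mp p0 Pp]; rewrite Pp; last by rewrite -[X in measurable X]setTI; exact: mp.
by apply: integral0_eq => x /= ->.
Qed.

End Density.

(** * Independence of the next observation from the past *)

Section IndependentPast.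
Context (R : realType) (dO dX : measure_display) (Omega : measurableType dO)
  (X : measurableType dX) (Q : probability Omega R) (Y : nat -> {RV Q >-> X}).

Definition past t (w : Omega) : t.-tuple X := [tuple Y i w | i < t].

Lemma measurable_past t : measurable_fun [set: Omega] (past t).
Proof.
apply/measurable_fun_tnthP => i.
rewrite (_ : _ \o _ = Y i)//.
by apply/funext => w /=; rewrite tnth_mktuple.
Qed.

HB.instance Definition _ t :=
  isMeasurableFun.Build _ _ _ _ (past t) (@measurable_past t).

Lemma measurable_past_pair t :
  measurable_fun [set: Omega] (fun w => (past t w, Y t w)).
Proof.
by apply: measurable_fun_pair; [exact: measurable_past|exact: measurable_funP].
Qed.

Lemma natural_filtration_preimage_past t A :
  measurable A -> natural_filtration Y t (past t @^-1` A).
Proof.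
move=> mA; rewrite /natural_filtration.
rewrite (_ : (fun i : 'I_t => _) = fun i => (@tnth t X)^~ i \o past t).
  by rewrite g_sigma_preimage_comp; exists A; rewrite ?setTI.
by apply/funext => i; apply/funext => w /=; rewrite tnth_mktuple.
Qed.

(** The pi-system that generates the natural filtration at time [t], used for uniqueness of
    measures. *)
Definition boxes t : set (set Omega) :=
  [set C | exists2 A : nat -> set X, (forall i, measurable (A i)) &
           C = [set w | forall i : 'I_t, A i (Y i w)]].

Lemma measurable_boxes t : boxes t `<=` measurable.
Proof.
move=> _ [A mA ->].
rewrite (_ : [set w | _] = \bigcap_(i in [set: 'I_t]) (Y i @^-1` A i)).
  by apply: fin_bigcap_measurable => // i _; exact: measurable_funPTI.
by apply/seteqP; split=> [w wA i _|w wA i]; [exact: wA|exact: (wA i I)].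
Qed.

Lemma natural_filtration_boxes t : natural_filtration Y t `<=` <<s boxes t >>.
Proof.
apply: smallest_sub; first exact: smallest_sigma_algebra.
move=> C; rewrite -bigcup_seq => -[i _ [B mB <-]].
apply: sub_sigma_algebra.
exists (fun j => if j == i :> nat then B else setT).
  by move=> j; case: ifP.
rewrite setTI; apply/seteqP; split=> [w /= wB j|w /= /(_ i)]; last by rewrite eqxx.
by case: ifPn => // /eqP/val_inj ->.
Qed.

Lemma natural_filtration_measurable t : natural_filtration Y t `<=` measurable.
Proof.
move=> A /natural_filtration_boxes; apply: smallest_sub.
- exact: sigma_algebra_measurable.
- exact: measurable_boxes.
Qed.

Lemma setI_closed_boxes t : setI_closed (boxes t).
Proof.
move=> _ _ [A mA ->] [B mB ->]; exists (fun i => A i `&` B i).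
  by move=> i; exact: measurableI.
by apply/seteqP; split=> [w [wA wB] i|w wAB]; [split|split=> i; case: (wAB i)].
Qed.

Hypothesis indepY : mutually_independent Y.

Lemma independent_box t (A : nat -> set X) B :
    (forall i, measurable (A i)) -> measurable B ->
  (Q ([set w | forall i : 'I_t, A i (Y i w)] `&` Y t @^-1` B) =
   Q [set w | forall i : 'I_t, A i (Y i w)] * Q (Y t @^-1` B))%E.
Proof.
move=> mA mB.
have capE n (C : nat -> set X) :
    \bigcap_(i in [set` [fset i | i in iota 0 n]%fset]) (Y i @^-1` C i) =
    [set w | forall i : 'I_n, C i (Y i w)].
  apply/seteqP; split=> [w wC i|w wC i] /=.
    by apply: wC => /=; rewrite !inE mem_iota /=.
  by rewrite !inE mem_iota /= => ni; exact: (wC (Ordinal ni)).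
have prodE n (C : nat -> set X) : (forall i, measurable (C i)) ->
    (Q [set w | forall i : 'I_n, C i (Y i w)] =
     \prod_(i < n) Q (Y i @^-1` C i))%E.
  move=> mC; rewrite -capE indepY//.
  rewrite -(big_mkord xpredT (fun i => Q (Y i @^-1` C i))) /index_iota subn0.
  by apply: perm_big; rewrite uniq_perm ?fset_uniq ?iota_uniq// => i; rewrite !inE.
(* Adding [B] as side number [t] turns the intersection into a box of length [t.+1], so both sides
   are products over initial segments. *)
pose C i := if i == t then B else A i.
rewrite (_ : _ `&` _ = [set w | forall i : 'I_t.+1, C i (Y i w)]); last first.
  apply/seteqP; split=> [w [/= wA wB] i|w /= wC].
    rewrite /C; case: eqP => [->//|/eqP nit].
    have it : (i < t)%N by rewrite ltn_neqAle nit -ltnS ltn_ord.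
    exact: (wA (Ordinal it)).
  split=> [i|] /=.
    by have := wC (widen_ord (leqnSn t) i); rewrite /C /= ltn_eqF.
  by have := wC ord_max; rewrite /C /= eqxx.
rewrite !prodE//; last by move=> i; rewrite /C; case: ifP.
rewrite big_ord_recr /= {2}/C eqxx; congr (_ * _)%E.
by apply: eq_bigr => i _; rewrite /C ltn_eqF.
Qed.

(** As functions of [A], the left side is the restriction of [Q] to the event that [Y t] lies in
    [B], and the right side is [Q] rescaled by a constant. These finite measures agree on boxes,
    hence on the generated sigma-algebra. *)
Lemma independent_natural_filtration t A B :
    natural_filtration Y t A -> measurable B ->
  (Q (A `&` Y t @^-1` B) = Q A * Q (Y t @^-1` B))%E.
Proof.
move=> FA mB.
have mYB : measurable (Y t @^-1` B) by exact: measurable_funPTI.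
have QYB0 : 0 <= fine (Q (Y t @^-1` B)) by rewrite fine_ge0.
have mscaleE C : (mscale (NngNum QYB0) Q C = Q C * Q (Y t @^-1` B))%E.
  by rewrite /mscale /= muleC fineK// fin_num_measure.
rewrite -mscaleE -[LHS]/(mrestr Q mYB A).
apply: (@g_sigma_algebra_measure_unique _ _ _ (boxes t) (@measurable_boxes t)
  (fun=> setT)).
- by move=> _; exists (fun=> setT) => //; apply/seteqP; split.
- by rewrite bigcup_const//; exists 0%N.
- exact: setI_closed_boxes.
- by move=> _ [C mC ->]; apply: (etrans _ (esym (mscaleE _))); exact: independent_box.
- by move=> _; rewrite /= /mrestr setTI -ge0_fin_numE// fin_num_measure.
- exact: natural_filtration_boxes.
Qed.

(** A substitute for conditional expectation: the joint law of the past and the next observation is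
    a product, so by Tonelli the next observation is integrated out with the past frozen at [u]. *)
Lemma le_integral_past t (h : t.-tuple X * X -> \bar R) (g : t.-tuple X -> \bar R) :
    measurable_fun [set: t.-tuple X * X] h -> (forall z, 0 <= h z)%E ->
    measurable_fun [set: t.-tuple X] g -> (forall u, 0 <= g u)%E ->
    (forall u, \int[distribution Q (Y t)]_x h (u, x) <= g u)%E ->
  (\int[Q]_w h (past t w, Y t w) <= \int[Q]_w g (past t w))%E.
Proof.
move=> mh h0 mg g0 hg; have mpastY := @measurable_past_pair t.
have -> : (\int[Q]_w h (past t w, Y t w) =
    \int[distribution Q (past t) \x distribution Q (Y t)]_z h z)%E.
  rewrite -(ge0_integral_pushforward mpastY Q measurableT mh)//.
  apply: eq_measure_integral => A mA _; apply/esym.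
  apply: product_measure_unique => // B C mB mC.
  by apply: independent_natural_filtration => //; exact: natural_filtration_preimage_past.
rewrite fubini_tonelli1// -[leRHS](@ge0_integral_distribution _ _ _ _ _ Q (past t))//.
apply: ge0_le_integral => //.
- by move=> u _; exact: integral_ge0.
- exact: measurable_fun_fubini_tonelli_F.
- by move=> u _; exact: hg.
Qed.

End IndependentPast.

(** * A maximal inequality of Ville type for products of bets *)

Section BettingInequality.
Context (R : realType) (dO dX : measure_display) (Omega : measurableType dO)
  (X : measurableType dX) (Q : probability Omega R) (Y : nat -> {RV Q >-> X}).
Hypothesis indepY : mutually_independent Y.

Variables (r : forall t, t.-tuple X * X -> R) (c : R).
Arguments r : clear implicits.
Hypothesis c_gt0 : 0 < c.
Hypothesis measurable_r : forall t, measurable_fun [set: t.-tuple X * X] (r t).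
Hypothesis r_ge0 : forall t z, 0 <= r t z.
Hypothesis integral_r_le1 : forall t u,
  (\int[distribution Q (Y t)]_x (r t (u, x))%:E <= 1)%E.

Definition wealth t (w : Omega) : R := \prod_(i < t) r i (past Y i w, Y i w).

Definition tuple_init t (u : t.+1.-tuple X) : t.-tuple X :=
  [tuple tnth u (widen_ord (leqnSn t) i) | i < t].

Lemma measurable_tuple_init t : measurable_fun [set: t.+1.-tuple X] (@tuple_init t).
Proof.
apply/measurable_fun_tnthP => i.
rewrite (_ : _ \o _ = (@tnth _ X)^~ (widen_ord (leqnSn t) i)).
  exact: measurable_tnth.
by apply/funext => u /=; rewrite tnth_mktuple.
Qed.

Lemma tuple_init_past t w : tuple_init (past Y t.+1 w) = past Y t w.
Proof. by apply: eq_from_tnth => i; rewrite !tnth_mktuple. Qed.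

(* The wealth as a function of the observed tuple, set to 0 forever once it has
   exceeded [c]. *)
Fixpoint capped_wealth t : t.-tuple X -> R :=
  if t is t'.+1 then fun u : t'.+1.-tuple X =>
    let v := capped_wealth (tuple_init u) *
             r t' (tuple_init u, tnth u ord_max) in
    if v <= c then v else 0
  else fun=> 1.

Lemma capped_wealth_ge0 t (u : t.-tuple X) : 0 <= capped_wealth u.
Proof.
elim: t u => [|t IH] u //=.
by case: ifP => // _; rewrite mulr_ge0.
Qed.

Lemma measurable_capped_wealth t :
  measurable_fun [set: t.-tuple X] (@capped_wealth t).
Proof.
elim: t => [|t IH] /=; first exact: measurable_cst.
have mv : measurable_fun [set: t.+1.-tuple X] (fun u =>
    capped_wealth (tuple_init u) * r t (tuple_init u, tnth u ord_max)).
  apply: measurable_funM.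
    exact: (measurableT_comp IH (@measurable_tuple_init t)).
  apply: (measurableT_comp (@measurable_r t)); apply: measurable_fun_pair.
    exact: measurable_tuple_init.
  exact: measurable_tnth.
apply: measurable_fun_ifT => //.
by apply: measurable_fun_ler.
Qed.

(** [D t] is the capped wealth before bet number [t], and [V t] the wealth right after that bet, not
    yet compared with [c]. The events [c < V t w] are disjoint, since [D] stays 0 after a
    crossing. *)
Let D t (w : Omega) := capped_wealth (past Y t w).
Let V t (w : Omega) := D t w * r t (past Y t w, Y t w).

Let D_succ t w : D t.+1 w = if V t w <= c then V t w else 0.
Proof. by rewrite /V /D /= tuple_init_past tnth_mktuple. Qed.

Let D_ge0 t w : 0 <= D t w. Proof. exact: capped_wealth_ge0. Qed.

Let V_ge0 t w : 0 <= V t w. Proof. by rewrite mulr_ge0. Qed.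

Let measurable_D t : measurable_fun [set: Omega] (D t).
Proof.
exact: (measurableT_comp (@measurable_capped_wealth t) (@measurable_past _ _ _ _ _ _ Y t)).
Qed.

Lemma measurable_r_past t :
  measurable_fun [set: Omega] (fun w => r t (past Y t w, Y t w)).
Proof.
exact: (measurableT_comp (@measurable_r t) (@measurable_past_pair _ _ _ _ _ _ Y t)).
Qed.

Let measurable_V t : measurable_fun [set: Omega] (V t).
Proof. by apply: measurable_funM => //; exact: measurable_r_past. Qed.

Let measurable_crossing t : measurable [set w | c < V t w].
Proof.
rewrite (_ : [set w | _] = V t @^-1` `]c, +oo[); last first.
  by apply/seteqP; split=> w /=; rewrite in_itv /= andbT.
by rewrite -[X in measurable X]setTI; exact: measurable_V.
Qed.

(** With the past frozen, the capped wealth is a constant factor and the bet has mean at most 1. *)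
Lemma integral_bet_le t :
  (\int[Q]_w (V t w)%:E <= \int[Q]_w (D t w)%:E)%E.
Proof.
apply: (le_integral_past indepY
  (h := fun z => (capped_wealth z.1 * r t z)%:E)
  (g := fun u => (capped_wealth u)%:E)).
- apply/measurable_EFinP; apply: measurable_funM; last exact: measurable_r.
  exact: (measurableT_comp (@measurable_capped_wealth t)).
- by move=> z /=; rewrite lee_fin mulr_ge0 ?capped_wealth_ge0.
- by apply/measurable_EFinP; exact: measurable_capped_wealth.
- by move=> u /=; rewrite lee_fin capped_wealth_ge0.
move=> u /=; under eq_integral do rewrite EFinM.
rewrite ge0_integralZl//.
- rewrite -[leRHS]mule1 lee_wpmul2l ?lee_fin ?capped_wealth_ge0//.
  exact: integral_r_le1.
- apply/measurable_EFinP.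
  exact: (measurableT_comp (@measurable_r t) (pair1_measurable u)).
- by move=> x _; rewrite lee_fin.
- by rewrite lee_fin capped_wealth_ge0.
Qed.

(** Pointwise, [V t] pays for both terms: without a crossing it equals [D t.+1], and at a crossing
    it exceeds [c] while [D t.+1] is 0. *)
Lemma crossing_budget t :
  (\int[Q]_w (D t.+1 w)%:E + c%:E * Q [set w | (c < V t w)%R] <=
   \int[Q]_w (D t w)%:E)%E.
Proof.
apply: le_trans (integral_bet_le t).
have cQE : (c%:E * Q [set w | (c < V t w)%R] =
    \int[Q]_w (c * \1_[set w | (c < V t w)%R] w)%:E)%E.
  under eq_integral do rewrite EFinM.
  rewrite ge0_integralZl ?lee_fin ?(ltW c_gt0)//.
  - by rewrite integral_indic// setIT.
  - exact/measurable_EFinP.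
have mE : measurable_fun [set: Omega]
    (fun w => (c * \1_[set w | (c < V t w)%R] w)%:E).
  by apply/measurable_EFinP; exact: measurable_funM.
have cE0 w : (0 <= (c * \1_[set w | (c < V t w)%R] w)%:E)%E.
  by rewrite lee_fin mulr_ge0 ?(ltW c_gt0).
rewrite cQE -ge0_integralD//; last 2 first.
- by move=> w _; rewrite lee_fin.
- exact/measurable_EFinP.
apply: ge0_le_integral => //.
- by move=> w _; rewrite adde_ge0 ?cE0 ?lee_fin ?D_ge0.
- by apply: emeasurable_funD => //; exact/measurable_EFinP.
- exact/measurable_EFinP.
move=> w _; rewrite -EFinD lee_fin D_succ indicE.
case: (leP (V t w) c) => Vc.
  by rewrite memNset ?mulr0 ?addr0//= ltNge Vc.
by rewrite mem_set// mulr1 add0r ltW.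
Qed.

Lemma sum_crossing t :
  (\int[Q]_w (D t w)%:E + c%:E * \sum_(i < t) Q [set w | (c < V i w)%R] <= 1)%E.
Proof.
elim: t => [|t IH].
  rewrite big_ord0 mule0 adde0 (eq_integral (cst 1%E))// integral_cst// mul1e.
  exact: probability_le1.
apply: le_trans IH; rewrite big_ord_recr /= ge0_muleDr//; last exact: sume_ge0.
by rewrite addeCA addeC leeD2r// crossing_budget.
Qed.

Lemma measurable_wealth t : measurable_fun [set: Omega] (wealth t).
Proof. by apply: measurable_prod => i _; exact: measurable_r_past. Qed.

Lemma measurable_wealth_exceeds :
  measurable [set w | exists t, c < wealth t.+1 w].
Proof.
rewrite (_ : [set w | _] = \bigcup_t (wealth t.+1 @^-1` `]c, +oo[)); last first.
  apply/seteqP; split=> [w [t ct]|w [t _] /=].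
    by exists t => //=; rewrite in_itv /= andbT.
  by rewrite in_itv /= andbT => ct; exists t.
apply: bigcup_measurable => t _.
by rewrite -[X in measurable X]setTI; exact: measurable_wealth.
Qed.

(** Without any crossing the cap never acts, so [D] is the true wealth and stays at most [c]. The
    event is thus covered by the crossings, whose probabilities have partial sums at most [c^-1]. *)
Lemma ville_betting :
  (Q [set w | exists t, (c < wealth t.+1 w)%R] <= c^-1%:E)%E.
Proof.
apply: (@le_trans _ _ (\sum_(0 <= i <oo) Q [set w | (c < V i w)%R])%E).
  apply: measure_sigma_subadditive => //; first exact: measurable_wealth_exceeds.
  move=> w [t ct]; apply: contrapT => nocross.
  have Vc i : V i w <= c by rewrite leNgt; apply/negP => cV; apply: nocross; exists i.
  have DE i : D i w = wealth i w.
    elim: i => [|i IH]; first by rewrite /wealth big_ord0.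
    by rewrite D_succ Vc /V IH /wealth big_ord_recr.
  by move: ct; rewrite -DE D_succ Vc ltNge Vc.
apply: lime_le; first by apply: is_cvg_nneseries => *; exact: measure_ge0.
apply: nearW => n; rewrite big_mkord -(@lee_pmul2l _ c%:E) ?lte_fin//.
rewrite -EFinM divff ?gt_eqF//; apply: le_trans (sum_crossing n).
by rewrite leeDr// integral_ge0// => w _; rewrite lee_fin.
Qed.

End BettingInequality.

(* With the conventions [a / 0 = +oo] for [0 < a] and [0 / 0 = 0], clearing the
   denominator is also correct at [b = 0]. *)
Lemma lee_divEFin (R : realType) (a b c : R) : 0 <= a -> 0 <= b -> 0 <= c ->
  (a%:E / b%:E <= c%:E)%E = (a <= c * b).
Proof.
move=> a0 b0 c0; have [->|bn0] := eqVneq b 0.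
  rewrite inve0 mulr0; have [->|an0] := eqVneq a 0.
    by rewrite mul0e lee_fin c0 lexx.
  have a_gt0 : 0 < a by rewrite lt_neqAle eq_sym an0.
  by rewrite gt0_muley ?lte_fin// leye_eq/= leNgt a_gt0.
rewrite inver (negbTE bn0) -EFinM lee_fin ler_pdivrMr//.
by rewrite lt_neqAle eq_sym bn0.
Qed.

Theorem theorem11 (R : realType) (alpha : R) (halpha : 0 < alpha < 1)
  (dX : measure_display) (X : measurableType dX)
  (mu : {measure set X -> \bar R})
  (Theta : Type) (P : Theta -> probability X R) (p : Theta -> X -> R)
  (hp : forall theta, is_density mu (P theta) (p theta))
  (dO : measure_display) (Omega : measurableType dO) (Q : probability Omega R)
  (thetas : Theta) (Y : nat -> {RV Q >-> X}) (hY : iid Y (P thetas))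
  (est : forall i : nat, i.-tuple X -> Theta)
  (hest : forall i : nat, measurable_fun [set: i.-tuple X * X]
            (fun z => p (est i z.1) z.2)) :
  let C t w := conf_set p est alpha (fun i => Y i w) t in
  let Cbar t w := running_conf_set p est alpha (fun i => Y i w) t in
  [/\ is_confidence_sequence Q C thetas alpha,
      is_confidence_sequence Q Cbar thetas alpha,
      (forall tau : Omega -> nat,
         is_stopping_time (natural_filtration Y) tau ->
         ((1 - alpha)%:E <= Q [set w | C (tau w) w thetas])%E) &
      (forall T : Omega -> nat,
         is_random_time T ->
         ((1 - alpha)%:E <= Q [set w | C (T w) w thetas])%E)].
Proof.
have /andP[alpha_gt0 alpha_lt1] := halpha.
have [indepY distY] := hY.
have p0 theta x : 0 <= p theta x by have [_ + _] := hp theta; exact.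
move=> C Cbar.
pose c := 1 / alpha.
have c_gt0 : 0 < c by rewrite divr_gt0.
pose q := p thetas.
have mq : measurable_fun [set: X] q by have [] := hp thetas.
(* This real quotient is 0 where [q] vanishes, unlike the extended quotient in [lik_ratio]; the two
   are compared only where [q] is positive. *)
pose r t (z : t.-tuple X * X) := p (est t z.1) z.2 / q z.2.
have mr t : measurable_fun [set: t.-tuple X * X] (r t).
  apply: measurable_fun_ratio => [|| z]; [exact: hest| |exact: p0].
  exact: (measurableT_comp mq).
have r0 t z : 0 <= r t z by rewrite divr_ge0 ?p0.
(* Once the past [u] is frozen, [est t u] is a single parameter, and its density is compared with
   the true one. *)
have Qle1 t u : (\int[distribution Q (Y t)]_x (r t (u, x))%:E <= 1)%E.
  apply: le_trans (integral_density_ratio_le1 (hp thetas) (hp (est t u))).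
  rewrite le_eqVlt; apply/orP; left; apply/eqP.
  by apply: eq_measure_integral => A mA _; exact: distY.
(* Clearing the denominator gives an inequality between real measurable functions that is exact even
   when the true likelihood is 0. *)
have CE t w : C t w thetas <->
    \prod_(i < t) p (est i (past Y i w)) (Y i w) <= c * \prod_(i < t) q (Y i w).
  by rewrite /C /conf_set /= /lik_ratio lee_divEFin ?prodr_ge0// ltW.
have mC t : measurable [set w | C t w thetas].
  rewrite (_ : [set w | _] = [set w | \prod_(i < t) p (est i (past Y i w)) (Y i w)
      <= c * \prod_(i < t) q (Y i w)]); last first.
    by apply/seteqP; split=> w /=; rewrite CE.
  have mle : measurable_fun [set: Omega] (fun w =>
      \prod_(i < t) p (est i (past Y i w)) (Y i w) <= c * \prod_(i < t) q (Y i w)).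
    apply: measurable_fun_ler.
      apply: measurable_prod => i _.
      exact: (measurableT_comp (@hest i) (@measurable_past_pair _ _ _ _ _ _ Y i)).
    apply: measurable_funM => //; apply: measurable_prod => i _.
    exact: measurableT_comp.
  by have := mle measurableT [set true] I; rewrite setTI.
have mB : measurable [set w | exists2 t, (1 <= t)%N & ~ C t w thetas].
  rewrite (_ : [set w | _] =
      \bigcup_(t in [set t | (1 <= t)%N]) ~` [set w | C t w thetas]).
    by apply: bigcup_measurable => t _; exact: measurableC.
  by apply/seteqP; split=> w [t t1 nC]; exists t.
have mnull i : measurable (Y i @^-1` (q @^-1` [set 0])).
  by apply: measurable_funPTI; rewrite -[X in measurable X]setTI; exact: mq.
have null i : Q (Y i @^-1` (q @^-1` [set 0])) = 0%E.
  rewrite -(density_eq0_null (hp thetas)) -(distY i)//.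
  by rewrite -[X in measurable X]setTI; exact: mq.
have QB : (Q [set w | exists2 t, (1 <= t)%N & ~ C t w thetas] <= alpha%:E)%E.
  (* Off the null set [Z] every denominator is positive, so failing to cover at time [t.+1] means
     that the wealth exceeds [c] there. *)
  set B := [set w | _]; set Z := \bigcup_i (Y i @^-1` (q @^-1` [set 0])).
  have mZ : measurable Z by exact: bigcup_measurable.
  have QZ : Q Z = 0%E.
    apply/eqP; rewrite eq_le measure_ge0 andbT.
    apply: le_trans (measure_sigma_subadditive Q mnull mZ (@subset_refl _ Z)) _.
    by rewrite eseries0 => [|i _ _]; [exact: lexx|exact: null].
  pose W := [set w | exists t, c < wealth Y r t.+1 w].
  have mW : measurable W by exact: measurable_wealth_exceeds.
  have BWZ : B `<=` W `|` Z.
    move=> w [[//|t] _ nC]; apply: contrapT => /not_orP[nW nZ].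
    apply/nC/CE; have q_gt0 i : 0 < q (Y i w).
      by rewrite lt_neqAle p0 andbT eq_sym; apply/eqP => q0; apply: nZ; exists i.
    rewrite -ler_pdivrMr ?prodr_gt0// -prodf_div leNgt.
    by apply/negP => cW; apply: nW; exists t.
  apply: (@le_trans _ _ (Q (W `|` Z))).
    by apply: le_measure; rewrite ?inE//; exact: measurableU.
  rewrite measureU0//; apply: le_trans (ville_betting indepY c_gt0 mr r0 Qle1) _.
  by rewrite /c div1r invrK.
(* Failing to cover at time [T w] is failing at some time, an event already bounded by [QB]. This
   serves stopping times and random times alike. *)
have QCbar T : (forall w, (1 <= T w)%N) -> measurable [set w | C (T w) w thetas] ->
    ((1 - alpha)%:E <= Q [set w | C (T w) w thetas])%E.
  move=> T1 mCT; rewrite -[X in Q X]setCK probability_setC; last exact: measurableC.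
  rewrite EFinB leeB//; apply: le_trans QB.
  by apply: le_measure; rewrite ?inE//; [exact: measurableC|move=> w nC; exists (T w)].
have mCT T : measurable_fun [set: Omega] T -> measurable [set w | C (T w) w thetas].
  move=> mT; rewrite (_ : [set w | _] =
      \bigcup_t (T @^-1` [set t] `&` [set w | C t w thetas])).
    apply: bigcup_measurable => t _; apply: measurableI => //.
    by rewrite -[X in measurable X]setTI; exact: mT.
  apply/seteqP; split=> [w Cw|w [t _ [/= -> //]]].
  by exists (T w).
split.
- exact: QB.
(* The two failure events coincide: the running intersection fails at [t] through some [s <= t], and
   it is contained in the set at [t] itself. *)
- rewrite /is_confidence_sequence (_ : [set w | _] =
      [set w | exists2 t, (1 <= t)%N & ~ C t w thetas]) //.
  apply/seteqP; split=> w [t t1 nC].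
    apply: contrapT => h; apply: nC => s /= /andP[s1 _].
    by apply: contrapT => nCs; apply: h; exists s.
  by exists t => // Ct; apply: nC; apply: Ct; rewrite /= t1 leqnn.
- move=> tau [tau1 mtau]; apply: QCbar => //; apply: mCT.
  move=> _ A _; rewrite setTI.
  rewrite (_ : tau @^-1` A = \bigcup_(t in A) (tau @^-1` [set t])); last first.
    by apply/seteqP; split=> [w Aw|w [t At /= ->//]]; exists (tau w).
  apply: bigcup_measurable => t _.
  have mle n : measurable [set w | (tau w <= n)%N].
    exact: (natural_filtration_measurable (mtau n)).
  (* The event that [tau] equals [t] is a difference of two consecutive sublevel events; the value
     0, which has no predecessor, is excluded by [tau1]. *)
  case: t => [|t].
    rewrite (_ : _ @^-1` _ = set0)//.
    by apply/seteqP; split=> w //= tau0; have := tau1 w; rewrite tau0.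
  rewrite (_ : _ @^-1` _ = [set w | (tau w <= t.+1)%N] `\` [set w | (tau w <= t)%N]).
    exact: measurableD.
  apply/seteqP; split=> w /=; first by move=> ->; rewrite ltnn.
  by move=> [le_tau /negP]; rewrite -ltnNge => lt_tau; apply/eqP; rewrite eqn_leq le_tau.
- by move=> T [T1 mT]; apply: QCbar => //; exact: mCT.
Qed.
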